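(* Let $n\ge 3$ be an integer and let $K=\{132,312\}\{321,213\}$. The number of equivalence classes of $S_n$ under $K$-equivalence is $\dfrac{n(n+1)}{2}-2$.
   Context: Permutations in $S_n$ are written as words $\pi_1\pi_2\cdots\pi_n$ in one-line notation. The order permutation of a word $u$ of $c$ distinct positive integers is the unique $\sigma\in S_c$ with $\sigma_i<\sigma_j$ iff $u_i<u_j$. A replacement partition $K$ of $S_c$ is a set partition of $S_c$; it is denoted by listing its parts with the one-element parts (and outer brackets) omitted, so here $K$ is the set partition of $S_3$ whose only parts of size greater than one are $\{132,312\}$ and $\{321,213\}$. The $K$-equivalence on $S_n$ is the equivalence relation generated by: $\phi\equiv\psi$ whenever $\phi=aub$ and $\psi=avb$ (concatenations) for some possibly empty words $a,b$ and words $u,v$ of length $c$ (so $u,v$ occupy the same $c$ consecutive positions) such that the order permutations of $u$ and $v$ lie in the same part of $K$. All equivalence classes are counted, including one-element classes. *)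

(* Defs.v *)
From mathcomp Require Import all_boot all_fingroup.
From mathcomp Require Import boolp.
From Stdlib Require Import Relation_Operators.

Set Implicit Arguments.
Unset Strict Implicit.
Unset Printing Implicit Defensive.

(* One-line notation on the letters 1, ..., n, whereas 'S_n permutes
   0, ..., n - 1. *)
Definition one_line n (p : 'S_n) : seq nat := [seq (p i).+1 | i <- enum 'I_n].

Definition order_perm c (s : 'S_c) (u : seq nat) : Prop :=
  size u = c /\
  forall i j : 'I_c, (s i < s j) = (nth 0 u i < nth 0 u j).

Definition listed_part c (P : seq (seq nat)) : {set 'S_c} :=
  [set s | one_line s \in P].

(* The parts listed in L, completed by the singletons of the permutations that
   L omits; a set partition only if L lists nonempty, pairwise disjoint sets of
   one-line words on 1, ..., c. *)
Definition replacement_partition c (L : seq (seq (seq nat))) : {set {set 'S_c}} :=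
  [set B in [seq listed_part c P | P <- L]]
  :|: [set [set s] | s : 'S_c & one_line s \notin flatten L].

Definition replacement_step c (K : {set {set 'S_c}}) n (phi psi : 'S_n) : Prop :=
  exists (a u v b : seq nat) (s t : 'S_c) (B : {set 'S_c}),
    [/\ one_line phi = a ++ u ++ b, one_line psi = a ++ v ++ b,
        order_perm s u, order_perm t v & [/\ B \in K, s \in B & t \in B]].

Definition K_equiv c (K : {set {set 'S_c}}) n : 'S_n -> 'S_n -> Prop :=
  clos_refl_sym_trans 'S_n (@replacement_step c K n).

Definition K_classes c (K : {set {set 'S_c}}) n : {set {set 'S_n}} :=
  equivalence_partition (fun phi psi => `[< K_equiv K phi psi >]) [set: 'S_n].

Definition K_132_312_321_213 : {set {set 'S_3}} :=
  replacement_partition 3 [:: [:: [:: 1; 3; 2]; [:: 3; 1; 2]];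
                              [:: [:: 3; 2; 1]; [:: 2; 1; 3]]].

Lemma one_line_inj n : injective (@one_line n).
Proof.
move=> p q /eq_in_map epq; apply/permP => i; apply/val_inj/eqP.
by rewrite -eqSS; apply/eqP/epq; rewrite mem_enum.
Qed.

Lemma one_line_onto3 (w : seq nat) :
  perm_eq w [:: 1; 2; 3] -> exists s : 'S_3, one_line s = w.
Proof.
move=> pw; have sw : size w = 3 by rewrite (perm_size pw).
have uw : uniq w by rewrite (perm_uniq pw).
have wP (i : 'I_3) : 0 < nth 0 w i <= 3.
  have : nth 0 w i \in [:: 1; 2; 3] by rewrite -(perm_mem pw) mem_nth ?sw.
  by rewrite !inE => /or3P[] /eqP ->.
have inj_f : injective (fun i : 'I_3 => inord (nth 0 w i).-1 : 'I_3).
  move=> i j /(congr1 val); case/andP: (wP i) => i0 i3; case/andP: (wP j) => j0 j3.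
  rewrite /= !inordK ?prednK // => /(congr1 succn); rewrite !prednK // => /eqP.
  by rewrite nth_uniq ?sw // => /eqP/val_inj.
exists (perm inj_f); apply: (@eq_from_nth _ 0); first by rewrite size_map size_enum_ord sw.
move=> k; rewrite size_map size_enum_ord => k3.
rewrite (nth_map ord0) ?size_enum_ord // permE.
have -> : nth ord0 (enum 'I_3) k = Ordinal k3 by apply/val_inj; rewrite /= nth_enum_ord.
have /andP[h0 h3] := wP (Ordinal k3).
by rewrite inordK prednK.
Qed.

Lemma partition_K_132_312_321_213 : partition K_132_312_321_213 [set: 'S_3].
Proof.
have KP (B : {set 'S_3}) : reflect
    [\/ B = listed_part 3 [:: [:: 1; 3; 2]; [:: 3; 1; 2]],
        B = listed_part 3 [:: [:: 3; 2; 1]; [:: 2; 1; 3]]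
      | exists2 s : 'S_3, one_line s \notin
          [:: [:: 1; 3; 2]; [:: 3; 1; 2]; [:: 3; 2; 1]; [:: 2; 1; 3]] & B = [set s]]
    (B \in K_132_312_321_213).
  rewrite !inE -orbA; apply: (iffP or3P) => -[].
  - by move/eqP; constructor 1.
  - by move/eqP; constructor 2.
  - by case/imsetP => s; rewrite inE; constructor 3; exists s.
  - by move=> ->; constructor 1.
  - by move=> ->; constructor 2.
  - case=> s sP ->; constructor 3; apply/imsetP; exists s => //; rewrite inE; exact: sP.
apply/and3P; split.
- apply/eqP/setP => s; rewrite inE; apply/bigcupP.
  have [] := boolP (one_line s \in [:: [:: 1; 3; 2]; [:: 3; 1; 2]]).
    by exists (listed_part 3 [:: [:: 1; 3; 2]; [:: 3; 1; 2]]); [apply/KP; constructor 1 | rewrite inE].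
  have [] := boolP (one_line s \in [:: [:: 3; 2; 1]; [:: 2; 1; 3]]).
    by exists (listed_part 3 [:: [:: 3; 2; 1]; [:: 2; 1; 3]]); [apply/KP; constructor 2 | rewrite inE].
  rewrite !inE => h1 h2; exists [set s]; last by rewrite inE.
  by apply/KP; constructor 3; exists s; rewrite // !inE orbA negb_or h2.
- apply/trivIsetP => A B /KP hA /KP hB neAB; rewrite -setI_eq0; apply/eqP/setP => s.
  rewrite in_set0 in_setI; apply: contraNF neAB => /andP[hsA hsB]; apply/eqP; move: hsA hsB.
  case: hA => [->|->|[t ht ->]]; case: hB => [->|->|[r hr ->]] //;
    rewrite ?in_set1 ?[s \in listed_part _ _]inE.
  - by rewrite !inE => /orP[] /eqP ->.
  - move=> h /eqP e; move: hr h; rewrite e !inE => /norP[/negPf -> /norP[/negPf -> _]] //.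
  - by rewrite !inE => /orP[] /eqP ->.
  - move=> h /eqP e; move: hr h; rewrite e !inE => /norP[_ /norP[_ /negPf ->]] //.
  - move=> /eqP e; move: ht; rewrite e !inE => /norP[/negPf -> /norP[/negPf -> _]] //.
  - move=> /eqP e; move: ht; rewrite e !inE => /norP[_ /norP[_ /negPf ->]] //.
  by move=> /eqP <- /eqP <-.
- apply/negP => /KP[/setP h|/setP h|[s _ /setP/(_ s)]]; last by rewrite !inE eqxx.
  + by have [s es] := @one_line_onto3 [:: 1; 3; 2] isT; move: (h s); rewrite !inE es.
  + by have [s es] := @one_line_onto3 [:: 3; 2; 1] isT; move: (h s); rewrite !inE es.
Qed.

(* Main.v *)
Require Import Defs.
From mathcomp Require Import all_boot all_fingroup.
From mathcomp Require Import boolp zify.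
From Stdlib Require Import Relation_Operators.

Set Implicit Arguments.
Unset Strict Implicit.
Unset Printing Implicit Defensive.

(** Write a < b < c for three adjacent letters. The equivalence is generated by
    the two moves acb <-> cab and bac <-> cba; for both of them the largest
    letter travels while the other two keep their relative order. Hence erasing
    the letter n maps classes of S_n to classes of S_(n-1) (eqv_filter), and
    putting n in front is a section of that map (eqv_cons_max). So the number of
    classes of S_n is that of S_(n-1) plus the number of classes containing no
    word that starts with n. The words of the latter classes, called exceptional
    here, are the following.
    - The increasing word: none of its factors can be moved.
    - An increasing word followed by a letter a smaller than its last two
      letters, with 1 <= a <= n - 2: again no factor can be moved.
    - For n >= 4, the words obtained by inserting the factor 21 anywhere in
      34...n: they form one class, in which 21 travels.
    For n >= 4 this makes 1 + (n - 2) + 1 = n new classes, and S_3 has 4 classes.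

    The main point is that there are no further exceptional classes
    (exceptional_headed). Fix the other letters x_1 ... x_(n-1). Sliding the
    largest letter N to the right starting in front of x_1, it can jump over one
    letter if the next two form an ascent, and over two letters if they form a
    descent. From any place it so reaches either the last place or the last but
    one; the function slides_to_end tells which one is reached from the front.
    A word is therefore equivalent to w N or to u N x. Changing w, respectively u,
    within its class, one reaches a word starting with N unless
    - in w N, no word equivalent to w slides N to the end, or
    - in u N x, no word equivalent to u slides N to the end and all of them end
      with a letter larger than x.
    A joint induction on the length (exceptional_or_headed,
    stuck_sorted_or_spliced) shows that words which never slide a larger letter
    to the end are increasing or arise by inserting ba into an increasing word
    whose letters all exceed b > a. These give the exceptional words, except
    that u N x with u of the second kind needs an explicit computation
    (splice_penult_headed).

    The list normal_forms n contains one word per class; the last part transfers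
    the count to the equivalence on S_n. *)

(** * Moves on words *)

(** One move, oriented so that the largest of the three letters goes left. The
    words have arbitrary natural numbers as letters, so that factors of
    permutations need no renumbering. *)
Inductive step : seq nat -> seq nat -> Prop :=
| step_132 a b c s : a < b -> b < c -> step [:: a, c, b & s] [:: c, a, b & s]
| step_213 a b c s : a < b -> b < c -> step [:: b, a, c & s] [:: c, b, a & s]
| step_cons h w w' : step w w' -> step (h :: w) (h :: w').

(** The equivalence generated by the moves. *)
Definition eqv : seq nat -> seq nat -> Prop := clos_refl_sym_trans _ step.

Lemma eqv_refl w : eqv w w. Proof. exact: rst_refl. Qed.

Lemma eqv_sym w w' : eqv w w' -> eqv w' w. Proof. exact: rst_sym. Qed.

Lemma eqv_trans w w' w'' : eqv w w' -> eqv w' w'' -> eqv w w''.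
Proof. exact: rst_trans. Qed.

Lemma step_catl l w w' : step w w' -> step (l ++ w) (l ++ w').
Proof. by move=> st; elim: l => //= h l; apply: step_cons. Qed.

Lemma step_catr r w w' : step w w' -> step (w ++ r) (w' ++ r).
Proof. by elim=> *; [apply: step_132 | apply: step_213 | apply: step_cons]. Qed.

Lemma eqv_map (f : seq nat -> seq nat) :
  (forall w w', step w w' -> eqv (f w) (f w')) ->
  forall w w', eqv w w' -> eqv (f w) (f w').
Proof.
move=> fP w w'; elim=> [x y /fP //|x|x y _ /eqv_sym //|x y z _ xy _ yz].
- exact: eqv_refl.
- exact: eqv_trans xy yz.
Qed.

Lemma eqv_catl l w w' : eqv w w' -> eqv (l ++ w) (l ++ w').
Proof. by apply: eqv_map => u v uv; apply: rst_step; apply: step_catl. Qed.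

Lemma eqv_catr r w w' : eqv w w' -> eqv (w ++ r) (w' ++ r).
Proof.
by apply: (@eqv_map (fun w => w ++ r)) => u v uv; apply: rst_step; apply: step_catr.
Qed.

Lemma eqv_cons h w w' : eqv w w' -> eqv (h :: w) (h :: w').
Proof. exact: (@eqv_catl [:: h]). Qed.

Lemma eqv_132 a b c s : a < b -> b < c -> eqv [:: a, c, b & s] [:: c, a, b & s].
Proof. by move=> ab bc; apply/rst_step/step_132. Qed.

Lemma eqv_213 a b c s : a < b -> b < c -> eqv [:: b, a, c & s] [:: c, b, a & s].
Proof. by move=> ab bc; apply/rst_step/step_213. Qed.

Lemma eqv_invariant (P : seq nat -> Prop) :
  (forall w w', step w w' -> P w <-> P w') ->
  forall w w', eqv w w' -> P w <-> P w'.
Proof.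
move=> PP w w'; elim=> [x y /PP //|x //|x y _ []|x y z _ [? ?] _ [? ?]] //.
by split; auto.
Qed.

Lemma eqv_perm w w' : eqv w w' -> perm_eq w w'.
Proof.
elim=> [x y|x //|x y _|x y z _ xy _]; last exact: perm_trans; last by rewrite perm_sym.
elim=> [a b c s _ _|a b c s _ _|h u v _]; last by rewrite perm_cons.
- by rewrite (perm_catCA [:: a] [:: c]).
- by rewrite (perm_catCA [:: b; a] [:: c]).
Qed.

Lemma uniq_eqv w w' : eqv w w' -> uniq w = uniq w'.
Proof. by move=> /eqv_perm/perm_uniq. Qed.

Lemma all_eqv (p : pred nat) w w' : eqv w w' -> all p w = all p w'.
Proof. by move=> /eqv_perm/perm_all. Qed.

Lemma size_eqv w w' : eqv w w' -> size w = size w'.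
Proof. by move=> /eqv_perm/perm_size. Qed.

Lemma eqv_rcons N w w' : eqv w w' -> eqv (rcons w N) (rcons w' N).
Proof. by rewrite -!cats1; apply: eqv_catr. Qed.

(** * Deleting the largest letters *)

Lemma step_filter N w w' : step w w' ->
  eqv [seq x <- w | x < N] [seq x <- w' | x < N].
Proof.
elim=> [a b c s ab bc|a b c s ab bc|h u v _ uv] /=; last first.
- by case: (h < N) => //; apply: eqv_cons.
- have [cN|Nc] := ltnP c N; last by case: (b < N); case: (a < N); apply: eqv_refl.
  have -> : b < N by lia.
  have -> : a < N by lia.
  by apply: eqv_213.
- have [cN|Nc] := ltnP c N; last by case: (b < N); case: (a < N); apply: eqv_refl.
  have -> : b < N by lia.
  have -> : a < N by lia.
  by apply: eqv_132.
Qed.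

(** Erasing all the letters that are at least N respects the equivalence: this
    keeps the smaller letters of each moved factor, in an unchanged order unless
    all three of them stay. *)
Lemma eqv_filter N w w' : eqv w w' ->
  eqv [seq x <- w | x < N] [seq x <- w' | x < N].
Proof. exact: (eqv_map (@step_filter N)). Qed.

Lemma eqv_cons_max N v v' : all (gtn N) v -> all (gtn N) v' ->
  eqv (N :: v) (N :: v') -> eqv v v'.
Proof.
move=> /all_filterP vN /all_filterP vN' /(eqv_filter N) /=.
by rewrite ltnn [filter _ _]vN [filter _ _]vN'.
Qed.

(** * Sliding a largest letter *)

(** Where a letter N larger than all letters of w ends when it slides to the
    right from the front of w, jumping over x if the next letters x y satisfy
    x < y and over x y if not: true if N passes the whole word, false if it stops
    before the last letter. *)
Fixpoint slides_to_end (w : seq nat) : bool :=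
  if w is x :: s then
    if s is y :: s' then (if x < y then slides_to_end s else slides_to_end s') else false
  else true.

Lemma slides_to_end_descent x y s : y < x ->
  slides_to_end [:: x, y & s] = slides_to_end s.
Proof. by move=> yx /=; rewrite ltnNge (ltnW yx). Qed.

Lemma slides_to_end_rcons u x :
  slides_to_end (rcons u x) = ~~ slides_to_end u && ~~ (last 0 u < x).
Proof.
have [n] := ubnP (size u); elim: n u => // n IH [|y [|z s]] //= /ltnSE sn.
case: (y < z); first exact: (IH (z :: s) sn).
by rewrite IH; [case: s {sn IH} | lia].
Qed.

(** Both outcomes are proved together, by induction along the slide. *)
Lemma slide N w : all (gtn N) w -> uniq w ->
  (slides_to_end w -> eqv (N :: w) (rcons w N)) /\
  (forall u x, w = rcons u x -> ~~ slides_to_end w -> eqv (N :: w) (u ++ [:: N; x])).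
Proof.
have [n] := ubnP (size w); elim: n w => // n IH [|y [|z s]] /ltnSE sn wN uw.
- by split=> [_|[]//]; apply: eqv_refl.
- split=> // -[|y' u] x [] //; last by case: u.
  by move=> -> _; apply: eqv_refl.
move: wN uw => /= /and3P[yN zN sN] /and3P[]; rewrite inE negb_or => /andP[yz ys] zs us.
have [{}yz|{}zy] := ltnP y z.
  have [||| I1 I2] := IH (z :: s) => //=; rewrite ?zN ?zs //.
  have h : eqv [:: N, y, z & s] (y :: N :: z :: s) by apply/eqv_sym/eqv_132.
  split=> [t | [|y' u] x [] // ey e t]; apply: eqv_trans h _.
    by apply: eqv_cons; apply: I1.
  by subst y'; apply: eqv_cons; apply: I2.
have {}zy : z < y by lia.
have h : eqv [:: N, y, z & s] [:: y, z, N & s] by apply/eqv_sym/eqv_213.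
have [||| I1 I2] := IH s => //; first by move: sn => /=; lia.
split=> [t | [|y' [|z' u]] x [] // ey ez e t]; apply: eqv_trans h _.
- by do 2!apply: eqv_cons; apply: I1.
- by rewrite e in t *.
- by subst y' z'; do 2!apply: eqv_cons; apply: I2.
Qed.

Lemma slide_last N w : all (gtn N) w -> uniq w -> slides_to_end w ->
  eqv (N :: w) (rcons w N).
Proof. by move=> wN uw; case: (slide wN uw). Qed.

Lemma slide_penult N u x : all (gtn N) (rcons u x) -> uniq (rcons u x) ->
  ~~ slides_to_end (rcons u x) -> eqv (N :: rcons u x) (u ++ [:: N; x]).
Proof. by move=> wN uw; case: (slide wN uw) => _; apply. Qed.

Lemma slides_to_end_sorted w : w != [::] -> sorted ltn w -> slides_to_end w = false.
Proof.
elim: w => // x [|y s] //= IH _ /andP[-> ys]; exact: IH.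
Qed.

(** * Exceptional words *)

(** An increasing word of length at least 2 followed by a letter smaller than
    its last two letters. *)
Definition low_ended (w : seq nat) : Prop :=
  exists s y N x, [/\ w = s ++ [:: y; N; x], sorted ltn (s ++ [:: y; N]) & x < y].

(** The word w is t with the factor ba inserted somewhere. *)
Definition splice b a (t w : seq nat) : Prop :=
  exists p q, w = p ++ [:: b, a & q] /\ t = p ++ q.

(** The word is a nonempty increasing word with a factor ba inserted, where
    a < b and b is below all the other letters. *)
Definition spliced (w : seq nat) : Prop :=
  exists b a t, [/\ sorted ltn [:: a, b & t], t != [::] & splice b a t w].

(** All factors of length 3 have the pattern 123 or 231, which occur in no
    move. *)
Fixpoint rigid (w : seq nat) : bool :=
  if w is x :: s then
    (if s is y :: z :: _ then (x < y) && ((y < z) || (z < x)) else true) && rigid s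
  else true.

Lemma rigid_step w w' : step w w' -> ~~ rigid w /\ ~~ rigid w'.
Proof.
elim=> [a b c s ab bc|a b c s ab bc|h u v _ [uP vP]] /=; last first.
- by split; apply/negP => /andP[_]; apply/negP.
- by split; apply/negP => /andP[? _]; lia.
- by split; apply/negP => /andP[? _]; lia.
Qed.

Lemma rigid_eqv w w' : rigid w -> eqv w w' -> w' = w.
Proof.
move=> rw /(@eqv_invariant (fun v => v = w)) [u v /rigid_step[nu nv]|]; last by auto.
by split=> e; subst; [rewrite rw in nu | rewrite rw in nv].
Qed.

Lemma sorted_rigid w : sorted ltn w -> rigid w.
Proof.
elim: w => //= x [|y [|z s]] //= IH /and3P[xy yz zs].
by rewrite yz zs in IH *; rewrite xy /=; apply: IH.
Qed.

Lemma low_ended_rigid w : low_ended w -> rigid w.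
Proof.
case=> s [y [N [x [-> srt xy]]]]; elim: s srt => [|z s IH] /=.
  by rewrite !andbT => yN; rewrite yN xy orbT.
move=> zs; have srt := path_sorted zs; rewrite (IH srt) andbT.
case: s zs {IH srt} => [|z' [|z'' s]] /=.
- by rewrite andbT => /andP[-> ->].
- by move=> /and4P[-> ->].
- by move=> /and3P[-> ->].
Qed.

(** A move on such a word can only exchange the factor ba with an adjacent
    letter. *)
Lemma splice_step b a t w w' : sorted ltn [:: a, b & t] -> step w w' ->
  splice b a t w <-> splice b a t w'.
Proof.
move=> srt st; elim: st t srt => {w w'} [x y z s xy yz|x y z s xy yz|h u v uv IH] t srt.
- split=> -[[|p1 [|p2 [|p3 p]]] [q [/= e et]]]; case: e => *; subst; move: srt => /=; lia.
- split=> -[[|p1 [|p2 [|p3 p]]] [q [/= e et]]]; case: e => *; subst; move: srt => /=;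
    try lia.
  + by move=> _; eexists [:: _], _; split; reflexivity.
  + by move=> _; eexists [::], (_ :: _); split; reflexivity.
have [nu nv] := rigid_step uv.
(* The move is inside w minus its first letter b: impossible, since what
   follows b is increasing. *)
have aux (x : seq nat) (q : seq nat) : ~~ rigid x -> x = a :: q ->
    sorted ltn [:: a, b & q] -> False.
  move=> nx ex /= /andP[ab bq]; case/negP: nx; subst; apply: sorted_rigid => /=.
  by case: q bq => //= c q /andP[bc ->]; rewrite (ltn_trans ab bc).
have sub c p q : sorted ltn [:: a, b & (c :: p) ++ q] -> sorted ltn [:: a, b & p ++ q].
  move=> /=; case/and3P => -> bc; case: (p ++ q) => //= d r /andP[cd ->].
  by rewrite (ltn_trans bc cd).
split=> -[[|c p] [q [/= [eh e] et]]]; subst.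
- by case: (aux _ _ nu erefl srt).
- have /(IH _ (sub _ _ _ srt))[p' [q' [ev et']]] : splice b a (p ++ q) (p ++ [:: b, a & q]).
    by exists p, q.
  by exists (c :: p'), q'; rewrite /= ev et'.
- by case: (aux _ _ nv erefl srt).
- have /(IH _ (sub _ _ _ srt))[p' [q' [ev et']]] : splice b a (p ++ q) (p ++ [:: b, a & q]).
    by exists p, q.
  by exists (c :: p'), q'; rewrite /= ev et'.
Qed.

Lemma splice_eqv b a t w w' : sorted ltn [:: a, b & t] -> eqv w w' ->
  splice b a t w -> splice b a t w'.
Proof.
by move=> srt /(@eqv_invariant (splice b a t)) [u v|//]; apply: splice_step.
Qed.

Lemma spliced_eqv w w' : eqv w w' -> spliced w -> spliced w'.
Proof.
move=> e [b [a [t [srt t0 sp]]]]; exists b, a, t; split=> //.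
exact: splice_eqv e sp.
Qed.

Lemma splice_connected b a t p q : sorted ltn [:: a, b & t] -> t = p ++ q ->
  eqv [:: b, a & t] (p ++ [:: b, a & q]).
Proof.
move=> srt et; subst t.
elim: p srt => [|c p IH] /= srt; first exact: eqv_refl.
case/and3P: srt => ab bc pq.
apply: eqv_trans (eqv_213 _ ab bc) _.
apply: eqv_cons; apply: IH; rewrite /= ab /=.
by case: (p ++ q) pq => //= d r /andP[cd ->]; rewrite (ltn_trans bc cd).
Qed.

(** Among the words of at least two distinct letters, those that are equivalent
    to no word starting with its largest letter.
    The bound on the size excludes bax and xba with a < b < x: the second word
    starts with its largest letter. *)
Definition exceptional w := [\/ sorted ltn w, low_ended w | spliced w /\ 3 < size w].

Lemma exceptional_eqv w w' : eqv w w' -> exceptional w -> exceptional w'.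
Proof.
move=> e [s|A|[C sz]].
- by rewrite (rigid_eqv (sorted_rigid s) e); constructor 1.
- by rewrite (rigid_eqv (low_ended_rigid A) e); constructor 2.
- by constructor 3; rewrite -(perm_size (eqv_perm e)); split=> //; apply: spliced_eqv C.
Qed.

(** Some equivalent word starts with its largest letter. *)
Definition headed w := exists N v, all (gtn N) v /\ eqv w (N :: v).

(** A letter N larger than those of w, put in front of any word equivalent to
    w, slides to the last place but one. *)
Definition stuck w := forall w', eqv w w' -> ~~ slides_to_end w'.

Lemma max_split w : w != [::] -> uniq w ->
  exists N w1 w2, w = w1 ++ N :: w2 /\ all (gtn N) (w1 ++ w2).
Proof.
move=> w0 uw.
have [N Nw Nmax] : exists2 N, N \in w & forall y, y \in w -> y <= N.
  elim: w w0 {uw} => // x [|y s] IH _.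
    by exists x; rewrite ?inE // => z; rewrite inE => /eqP ->.
  have [//|N Nw Nm] := IH; have [xN|Nx] := leqP x N.
    by exists N; [rewrite inE Nw orbT | move=> z; rewrite inE => /orP[/eqP ->|/Nm]].
  exists x; first by rewrite inE eqxx.
  by move=> z; rewrite inE => /orP[/eqP ->|/Nm] //; lia.
case/splitPr: w / Nw uw Nmax {w0} => w1 w2.
rewrite (perm_uniq (permEl (perm_catCA w1 [:: N] w2))) /= => /andP[Nw _] Nmax.
exists N, w1, w2; split=> //; apply/allP => y yw /=.
have : y <= N by apply: Nmax; move: yw; rewrite !mem_cat inE orbCA => ->; rewrite orbT.
by rewrite leq_eqVlt => /orP[/eqP e|//]; rewrite -e yw in Nw.
Qed.

(** Here ba stands at the end of the increasing word t y, so the word is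
    t y b a N x with x < a < b and all letters of t y between b and N. *)
Lemma splice_penult_headed N t y a b x :
  all (gtn N) (rcons t y) -> sorted ltn [:: x, a, b & rcons t y] ->
  headed (rcons t y ++ [:: b; a; N; x]).
Proof.
move=> tyN srt.
have uty : uniq (rcons t y) by have /= /and4P[] := sorted_uniq ltn_trans ltnn srt.
have sty : sorted ltn (rcons t y).
  by apply: (subseq_sorted ltn_trans _ srt); apply: (suffix_subseq [:: x; a; b]).
have [xa ab bt] : [/\ x < a, a < b & all (ltn b) (rcons t y)].
  by case/and3P: srt => xa ab bt; split=> //; apply: (order_path_min ltn_trans bt).
have by_ : b < y by apply: (allP bt); rewrite mem_rcons mem_head.
have yN : y < N by apply: (allP tyN); rewrite mem_rcons mem_head.
have bN := ltn_trans by_ yN; have aN := ltn_trans ab bN; have xN := ltn_trans xa aN.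
exists N, (rcons t y ++ [:: a; x; b]); split.
  by rewrite all_cat tyN /= aN xN bN.
have slid : eqv (t ++ [:: N; y]) (N :: rcons t y).
  apply/eqv_sym/slide_penult => //.
  by rewrite (slides_to_end_sorted _ sty) //; case: (t).
apply: eqv_trans (eqv_catr [:: a; x; b] slid).
rewrite cat_rcons -catA; apply: eqv_catl => /=.
(* The end of the word runs through ybaNx, yNbax, yNaxb, yaxNb, yaNxb, Nyaxb. *)
apply: eqv_trans (eqv_cons y (eqv_213 [:: x] ab bN)) _.
apply: eqv_trans (eqv_cons y (eqv_cons N (eqv_sym (eqv_213 [::] xa ab)))) _.
apply: eqv_trans (eqv_cons y (eqv_sym (eqv_213 [:: b] xa aN))) _.
apply: eqv_trans (eqv_cons y (eqv_cons a (eqv_132 [::] (ltn_trans xa ab) bN))) _.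
exact: eqv_213 (ltn_trans ab by_) yN.
Qed.

Lemma headed_eqv w w' : eqv w w' -> headed w' -> headed w.
Proof. by move=> e [N [v [vN e']]]; exists N, v; split=> //; apply: eqv_trans e'. Qed.

Lemma spliced_front b a t : sorted ltn [:: a, b & t] -> t != [::] -> spliced [:: b, a & t].
Proof. by move=> srt t0; exists b, a, t; split=> //; exists [::], t. Qed.

Lemma spliced_canonical w : spliced w ->
  exists b a t, [/\ sorted ltn [:: a, b & t], t != [::] & eqv w [:: b, a & t]].
Proof.
case=> b [a [t [srt t0 [p [q [-> et]]]]]]; exists b, a, t; split=> //.
exact/eqv_sym/splice_connected.
Qed.

Lemma spliced_size w : spliced w -> 2 < size w.
Proof.
by move=> /spliced_canonical[b [a [[|c t] [_ // _ /eqv_perm/perm_size ->]]]].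
Qed.

Lemma slides_to_end_low_ended w : low_ended w -> slides_to_end w.
Proof.
case=> s [y [N [x [-> srt xy]]]].
have yN : y < N by move: srt; rewrite sorted_cat_cons /=; case/andP => _ /andP[].
have -> : s ++ [:: y; N; x] = rcons (s ++ [:: y; N]) x by rewrite -cats1 -catA.
by rewrite slides_to_end_rcons slides_to_end_sorted ?last_cat /=; [lia | case: (s) | ].
Qed.

(** A maximal letter in the last place but one is reached at the start of a
    jump, which then passes the last letter. *)
Lemma slides_to_end_top_penult u N x : x < N -> all (gtn N) u ->
  slides_to_end (u ++ [:: N; x]).
Proof.
move=> xN uN; have -> : u ++ [:: N; x] = rcons (rcons u N) x by rewrite -!cats1 -catA.
rewrite slides_to_end_rcons last_rcons slides_to_end_rcons [N < x]ltnNge (ltnW xN) andbT.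
case: (lastP u) uN => // t y; rewrite all_rcons last_rcons => /andP[/= yN _].
by rewrite yN andbF.
Qed.

Lemma stuckPn w : ~ stuck w -> exists2 w', eqv w w' & slides_to_end w'.
Proof.
move=> /existsNP[w' /not_implyP[e /negP]]; rewrite negbK => t; by exists w'.
Qed.

Lemma sorted_rcons_max N s : sorted ltn s -> all (gtn N) s -> sorted ltn (rcons s N).
Proof.
case: s => // x s srt sN /=; rewrite rcons_path; apply/andP; split=> //.
exact: (allP sN _ (mem_last x s)).
Qed.

Lemma sorted_drop2 a b t : sorted ltn [:: a, b & t] -> sorted ltn (a :: t).
Proof.
exact/(subseq_sorted ltn_trans)/(cat_subseq (subseq_refl [:: a]) (subseq_cons t b)).
Qed.

(** Induction hypothesis shared by the next two lemmas. *)
Definition stuck_below n :=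
  forall w, size w < n -> uniq w -> stuck w -> sorted ltn w \/ spliced w.

Lemma exceptional_or_headed n w : stuck_below n -> size w = n -> uniq w ->
  w != [::] -> exceptional w \/ headed w.
Proof.
move=> stuckP szw uw w0.
have [N [w1 [w2 [ew wN]]]] := max_split w0 uw.
have uN : N \notin w1 ++ w2 /\ uniq (w1 ++ w2).
  by move: uw; rewrite ew (perm_uniq (permEl (perm_catCA w1 [:: N] w2))) => /andP[].
have szw' : (size (w1 ++ w2)).+1 = n by rewrite -szw ew !size_cat /= addnS.
have {uN} uw' := uN.2.
have [u1 u2] : uniq w1 /\ uniq w2 by move: uw'; rewrite cat_uniq => /and3P[].
have [a1 a2] : all (gtn N) w1 /\ all (gtn N) w2 by apply/andP; rewrite -all_cat.
have [t2|nt2] := boolP (slides_to_end w2).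
  (* The largest letter can be moved to the end. *)
  have e : eqv w (rcons (w1 ++ w2) N).
    by rewrite ew rcons_cat; apply: eqv_catl; apply: slide_last.
  have [st|/stuckPn[w' e' t']] := EM (stuck (w1 ++ w2)); last first.
    right; exists N, w'; split; first by rewrite -(all_eqv _ e').
    apply: eqv_trans e _; apply: eqv_trans (eqv_rcons N e') _; apply: eqv_sym.
    by apply: slide_last; rewrite -?(all_eqv _ e') -?(uniq_eqv e').
  left; apply: exceptional_eqv (eqv_sym e) _.
  have szlt : size (w1 ++ w2) < n by rewrite -szw'.
  have [srt|[b [a [t [srt t0 [p [q [epq et]]]]]]]] := stuckP _ szlt uw' st.
    by constructor 1; apply: sorted_rcons_max.
  constructor 3; rewrite epq; split; last first.
    by rewrite size_rcons ltnS; apply: spliced_size; exists b, a, t; split=> //; exists p, q.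
  exists b, a, (rcons t N); split; last first.
  - by exists p, (rcons q N); rewrite et !rcons_cat.
  - by case: (t).
  apply: (@sorted_rcons_max N [:: a, b & t]) => //.
  by move: wN; rewrite epq et /= !all_cat /= => /and4P[-> -> -> ->].
(* The largest letter can be moved to the last place but one. *)
case/lastP: w2 => [//|v x] in ew wN szw' uw' u2 a2 nt2 *.
rewrite -rcons_cat in wN szw' uw'; set u := w1 ++ v in wN szw' uw' *.
have e : eqv w (u ++ [:: N; x]).
  by rewrite ew /u -catA; apply: eqv_catl; apply: slide_penult.
have xN : x < N by move: wN; rewrite all_rcons => /andP[].
have uN : all (gtn N) u by move: wN; rewrite all_rcons => /andP[].
have uu : uniq u by move: uw'; rewrite rcons_uniq => /andP[].
have [[u' [eu tu]]|/forallNP alltr] :=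
    EM (exists u', eqv u u' /\ ~~ slides_to_end (rcons u' x)).
  right; apply: headed_eqv e _; exists N, (rcons u' x).
  have euu := eqv_rcons x eu.
  split; first by rewrite -(all_eqv _ euu).
  apply: eqv_trans (eqv_catr [:: N; x] eu) _; apply: eqv_sym.
  by apply: slide_penult; rewrite -?(all_eqv _ euu) -?(uniq_eqv euu).
have {}alltr u' : eqv u u' -> ~~ slides_to_end u' && ~~ (last 0 u' < x).
  by move=> eu; rewrite -slides_to_end_rcons; apply: contraT => h; case: (alltr u').
have stu : stuck u by move=> u' /alltr/andP[].
have xu u' : eqv u u' -> x < last 0 u'.
  move=> eu; have /andP[tu' lu'] := alltr _ eu.
  rewrite ltn_neqAle leqNgt lu' andbT.
  move: uw'; rewrite (uniq_eqv (eqv_rcons x eu)) rcons_uniq => /andP[xu' _].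
  case/lastP: u' xu' tu' {lu' eu} => // t y; rewrite last_rcons mem_rcons inE.
  by rewrite negb_or => /andP[].
have szlt : size u < n by rewrite -szw' size_rcons.
have [srt|Cu] := stuckP _ szlt uu stu.
  left; apply: exceptional_eqv (eqv_sym e) _; constructor 2.
  have := stu _ (eqv_refl u); have := xu _ (eqv_refl u).
  case/lastP: (u) srt uN => // t y srt tyN; rewrite last_rcons => xy _.
  exists t, y, N, x; split=> //; first by rewrite cat_rcons.
  by rewrite -cat_rcons cats1; apply: sorted_rcons_max.
(* ba can be moved to the end of u, whence x < a. *)
right; apply: headed_eqv e _.
have [b [a [t [srt t0 [p [q [epq et]]]]]]] := Cu.
have e2 : eqv u (t ++ [:: b; a]).
  rewrite epq; apply: eqv_trans (eqv_sym (splice_connected srt et)) _.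
  by apply: splice_connected => //; rewrite cats0.
have xa := xu _ e2; rewrite last_cat /= in xa.
apply: headed_eqv (eqv_catr [:: N; x] e2) _; rewrite -catA /=.
case/lastP: t t0 srt e2 {et} => // t y _ srt e2.
apply: splice_penult_headed; last by rewrite /= xa.
by move: uN; rewrite (all_eqv _ e2) all_cat => /andP[].
Qed.

Lemma stuck_sorted_or_spliced w : uniq w -> stuck w -> sorted ltn w \/ spliced w.
Proof.
have [n] := ubnP (size w); elim: n w => // n IHn w /ltnSE.
rewrite leq_eqVlt => /orP[/eqP szw|/IHn]; last by [].
move=> uw stw.
have excP k v : k <= n -> size v = k -> uniq v -> v != [::] -> exceptional v \/ headed v.
  move=> kn; apply: exceptional_or_headed => x xk; apply: IHn; exact: leq_trans xk kn.
have w0 : w != [::] by case: (w) (stw _ (eqv_refl w)).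
have [[srt|/slides_to_end_low_ended tw|[Cw _]]|[M [v [vM ewv]]]] :=
    excP _ _ (leqnn n) szw uw w0.
- by left.
- by have := stw _ (eqv_refl w); rewrite tw.
- by right.
have Mv_uniq : uniq (M :: v) by rewrite -(uniq_eqv ewv).
have uv : uniq v by case/andP: Mv_uniq.
have szv : size v < n by rewrite -szw (size_eqv ewv).
(* Otherwise M could be moved just before the last letter of v', and a letter
   larger than M would slide to the end of that word. *)
have trv v' : eqv v v' -> slides_to_end v'.
  move=> e; apply: contraT => nt; case/lastP: v' e nt => // v' x e nt.
  have xvM : all (gtn M) (rcons v' x) by rewrite -(all_eqv _ e).
  have e2 : eqv w (v' ++ [:: M; x]).
    apply: eqv_trans ewv _; apply: eqv_trans (eqv_cons M e) _.
    by apply: slide_penult; rewrite -?(uniq_eqv e).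
  have := stw _ e2; rewrite slides_to_end_top_penult //; move: xvM;
    by rewrite all_rcons => /andP[].
have [ev|v0] := eqVneq v [::].
  by left; rewrite ev in ewv; rewrite (rigid_eqv _ (eqv_sym ewv)).
have [[srt|Av|[/spliced_canonical[b [a [t [srt t0 e]]]] _]]|[L [v2 [v2L ev]]]] :=
    excP _ _ (ltnW szv) erefl uv v0.
- by have := trv _ (eqv_refl v); rewrite slides_to_end_sorted.
- have : slides_to_end (M :: v).
    case: Av => -[|h s] [y [N [x [ev srt xy]]]]; rewrite ev in vM *.
      case/andP: vM => yM _; case/andP: srt => yN _.
      by rewrite cat0s !slides_to_end_descent //; apply: ltn_trans yN.
    have hM : h < M by case/andP: vM.
    rewrite cat_cons slides_to_end_descent //.
    apply: slides_to_end_low_ended; exists s, y, N, x.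
    by split=> //; apply: path_sorted srt.
  by have /negPf-> := stw _ ewv.
- have := trv _ e; rewrite slides_to_end_descent; last by case/andP: srt.
  by rewrite slides_to_end_sorted //; case/andP: srt => _ /path_sorted.
have Lv_uniq : uniq (L :: v2) by rewrite -(uniq_eqv ev).
have uv2 : uniq v2 by case/andP: Lv_uniq.
(* If L could be moved to the end of v', then v' L would be equivalent to v and
   would not slide to the end. *)
have stv2 : stuck v2.
  move=> v' e; apply/negP => tv'.
  suff /trv : eqv v (rcons v' L) by rewrite slides_to_end_rcons tv'.
  apply: eqv_trans ev _; apply: eqv_trans (eqv_cons L e) _.
  by apply: slide_last; rewrite -?(all_eqv _ e) -?(uniq_eqv e).
have szv2 : size v2 < n by apply: leq_trans (ltnW szv); rewrite (size_eqv ev).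
have [srt|/spliced_canonical[b [a [t [srt t0 e]]]]] := IHn _ szv2 uv2 stv2; last first.
  have := trv _ (eqv_trans ev (eqv_cons L e)).
  move: v2L; rewrite (all_eqv _ e) => /andP[bL _].
  by rewrite slides_to_end_descent // slides_to_end_sorted // (sorted_drop2 srt).
case: v2 => [|x [|y s]] in srt v2L ev {Lv_uniq uv2 stv2 szv2} *.
- by have := trv _ ev.
(* The only surviving case is M L x with x < L < M, equivalent to L x M. *)
- right; have xL : x < L by case/andP: v2L.
  have LM : L < M by move: vM; rewrite (all_eqv _ ev) => /andP[].
  apply: (@spliced_eqv [:: L; x; M]); last by apply: spliced_front; rewrite //= xL LM.
  apply: eqv_trans (eqv_213 [::] xL LM) _; apply: eqv_sym.
  exact: eqv_trans ewv (eqv_cons M ev).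
have := trv _ ev; case/andP: v2L => xL _.
by rewrite slides_to_end_descent // slides_to_end_sorted //; case/andP: srt.
Qed.

Lemma exceptional_headed w : uniq w -> w != [::] -> exceptional w \/ headed w.
Proof.
by apply: (@exceptional_or_headed (size w)) => // v _; apply: stuck_sorted_or_spliced.
Qed.

(** * Normal forms *)

(** One word on 1, ..., n in each class, for n >= 1. The condition 2 < m means
    n >= 4. *)
Fixpoint normal_forms n : seq (seq nat) :=
  if n is m.+1 then
    [seq n :: v | v <- normal_forms m] ++
    iota 1 n :: [seq rcons (rem a (iota 1 n)) a | a <- iota 1 m.-1] ++
    (if 2 < m then [:: [:: 2, 1 & iota 3 m.-1]] else [::])
  else [::].

Lemma normal_forms_cases n w : w \in normal_forms n.+1 ->
  [\/ exists2 v, v \in normal_forms n & w = n.+1 :: v,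
      w = iota 1 n.+1,
      exists2 a, 0 < a < n & w = rcons (rem a (iota 1 n.+1)) a
    | 2 < n /\ w = [:: 2, 1 & iota 3 n.-1]].
Proof.
rewrite [normal_forms _]/= mem_cat inE mem_cat.
case/or4P => [/mapP[v vn ->]|/eqP ->|/mapP[a an ->]|].
- by constructor 1; exists v.
- by constructor 2.
- by constructor 3; exists a => //; move: an; rewrite mem_iota; lia.
- by case: ifP => // n2; rewrite inE => /eqP ->; constructor 4.
Qed.

Lemma iota1S n : iota 1 n.+1 = rcons (iota 1 n) n.+1.
Proof. by rewrite -[in LHS](addn1 n) iotaD cats1. Qed.

Lemma normal_forms_perm n w : w \in normal_forms n -> perm_eq w (iota 1 n).
Proof.
elim: n w => // n IH w /normal_forms_cases[[v /IH pv ->]|->|[a an ->]|[n2 ->]] //.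
- by rewrite iota1S perm_sym perm_rcons perm_cons perm_sym.
- rewrite perm_rcons perm_sym; apply: perm_to_rem; rewrite mem_iota; lia.
- by case: n n2 {IH} => [|[|n]] // _; exact/permEl/(perm_catCA [:: 2] [:: 1]).
Qed.

Lemma low_ended_normal n a : 0 < a < n -> low_ended (rcons (rem a (iota 1 n.+1)) a).
Proof.
case: n => [|n] an; first lia.
have e : rem a (iota 1 n.+2) = rem a (iota 1 n) ++ [:: n.+1; n.+2].
  rewrite !rem_filter ?iota_uniq // !iota1S -!cats1 !filter_cat -catA /=.
  by have [-> ->] : n.+1 != a /\ n.+2 != a by lia.
exists (rem a (iota 1 n)), n.+1, n.+2, a; split; last by lia.
- by rewrite e -cats1 -catA.
- by rewrite -e (subseq_sorted ltn_trans (rem_subseq _ _)) // iota_ltn_sorted.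
Qed.

(** Distinct normal forms are inequivalent. *)
Lemma normal_forms_inj n u v : u \in normal_forms n -> v \in normal_forms n ->
  eqv u v -> u = v.
Proof.
elim: n u v => // n IH.
have rig w : w \in normal_forms n.+1 ->
  [\/ exists2 v, v \in normal_forms n & w = n.+1 :: v, rigid w
    | 2 < n /\ w = [:: 2, 1 & iota 3 n.-1]].
  case/normal_forms_cases => [h|->|[a an ->]|h]; [by constructor 1| | |by constructor 3].
    by constructor 2; apply/sorted_rigid/iota_ltn_sorted.
  by constructor 2; apply/low_ended_rigid/low_ended_normal.
have max w : w \in normal_forms n -> all (gtn n.+1) w.
  by move=> /normal_forms_perm/perm_all ->; apply/allP => x; rewrite mem_iota /=; lia.
(* No word 3...j21(j+1)...(n+1) starts with n+1 when n > 2. *)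
have clash w : 2 < n -> ~ eqv [:: 2, 1 & iota 3 n.-1] (n.+1 :: w).
  move=> n2 e; have srt : sorted ltn [:: 1, 2 & iota 3 n.-1].
    by have := iota_ltn_sorted 1 n.+1; case: (n) n2.
  have [|p [q [ep et]]] := splice_eqv srt e; first by exists [::], (iota 3 n.-1).
  case: n n2 ep et {IH rig max srt e} => [|[|n]] // n2.
  by case: p => [|c p] //= [ec _] [ec' _]; lia.
move=> u v /rig[[u' nu ->]|ru _ /(rigid_eqv ru) //|[n2 ->]].
  case/rig => [[v' nv ->] e|rv /eqv_sym/(rigid_eqv rv) -> //|[n2 ->] /eqv_sym /clash] //.
  by congr cons; apply: IH => //; apply: eqv_cons_max e; apply: max.
by case/rig => [[v' nv ->] /clash|rv /eqv_sym/(rigid_eqv rv) -> //|[_ ->]].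
Qed.

Lemma normal_forms_complete n w : perm_eq w (iota 1 n.+1) ->
  exists2 v, v \in normal_forms n.+1 & eqv w v.
Proof.
elim: n w => [|n IH] w pw.
  exists [:: 1] => //.
  suff -> : w = [:: 1] by apply: eqv_refl.
  exact: perm_small_eq pw.
have uw : uniq w by rewrite (perm_uniq pw) iota_uniq.
have w0 : w != [::] by apply/eqP => e; move: (perm_size pw); rewrite e size_iota.
have sorted_iota s : sorted ltn s -> perm_eq s (iota 1 n.+2) -> s = iota 1 n.+2.
  by move=> ss ps; apply: (irr_sorted_eq ltn_trans ltnn) => //;
    [apply: iota_ltn_sorted | apply: perm_mem].
have normal_formsE v : v \in normal_forms n.+2 =
  [|| v \in [seq n.+2 :: v | v <- normal_forms n.+1], v == iota 1 n.+2,
    v \in [seq rcons (rem a (iota 1 n.+2)) a | a <- iota 1 n]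
  | v \in if 2 < n.+1 then [:: [:: 2, 1 & iota 3 n]] else [::]].
  by rewrite [normal_forms _]/= mem_cat inE mem_cat.
have [[srt|[s [y [N [x [ew srt xy]]]]]|[/spliced_canonical[b [a [t [srt t0 e]]]] sz]]
    |[N [v [vN e]]]] := exceptional_headed uw w0.
- exists w; last exact: eqv_refl.
  by rewrite normal_formsE (sorted_iota _ srt pw) eqxx orbT.
- have yN : y < N by move: srt; rewrite sorted_cat_cons /=; case/andP => _ /andP[].
  have inw z : z \in w -> 0 < z < n.+3 by rewrite (perm_mem pw) mem_iota; lia.
  have xw : x \in w by rewrite ew mem_cat !inE eqxx !orbT.
  have Nw : N \in w by rewrite ew mem_cat !inE eqxx !orbT.
  have ew' : w = rcons (s ++ [:: y; N]) x by rewrite ew -cats1 -catA.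
  have eu : s ++ [:: y; N] = rem x (iota 1 n.+2).
    apply: (irr_sorted_eq ltn_trans ltnn) => //.
      by apply: (subseq_sorted ltn_trans (rem_subseq _ _)); apply: iota_ltn_sorted.
    apply: perm_mem; rewrite -(perm_cons x) -perm_rcons -ew'.
    by apply: (perm_trans pw (perm_to_rem _)); rewrite -(perm_mem pw).
  exists w; last exact: eqv_refl.
  rewrite normal_formsE ew' eu (map_f (fun a => rcons (rem a (iota 1 n.+2)) a)) ?orbT //.
  by rewrite mem_iota; have := inw _ xw; have := inw _ Nw; lia.
- have e2 : [:: a, b & t] = iota 1 n.+2.
    apply: sorted_iota => //; rewrite (perm_catCA [:: a] [:: b] t).
    by apply: perm_trans pw; rewrite perm_sym; apply: eqv_perm e.
  have n1 : 2 < n.+1 by move: sz; rewrite (perm_size pw) size_iota.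
  exists [:: b, a & t] => //; rewrite normal_formsE n1.
  by case: e2 => -> -> ->; rewrite mem_seq1 eqxx !orbT.
- have pNv : perm_eq (N :: v) (iota 1 n.+2).
    by apply: perm_trans pw; rewrite perm_sym; apply: eqv_perm e.
  have eN : N = n.+2.
    have : N \in iota 1 n.+2 by rewrite -(perm_mem pNv) mem_head.
    have : n.+2 \in N :: v by rewrite (perm_mem pNv) mem_iota; lia.
    by rewrite mem_iota inE => /orP[/eqP //|/(allP vN) /=]; lia.
  subst N; have /IH[v' nv' e'] : perm_eq v (iota 1 n.+1).
    by move: pNv; rewrite iota1S perm_sym perm_rcons perm_cons perm_sym.
  exists (n.+2 :: v'); last exact: eqv_trans e (eqv_cons _ e').
  by rewrite normal_formsE map_f.
Qed.

Lemma normal_forms_uniq n : uniq (normal_forms n).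
Proof.
elim: n => // n IH.
have headA a v : 0 < a < n -> rcons (rem a (iota 1 n.+1)) a <> n.+1 :: v.
  by case: n {IH} => [|[|n]] an; [lia|lia|rewrite /=; case: (1 == a) => -[]].
have lastA a : 0 < a < n -> rcons (rem a (iota 1 n.+1)) a <> iota 1 n.+1.
  by rewrite iota1S => an /(congr1 (last 0)); rewrite !last_rcons; lia.
have rigidC : 2 < n -> rigid [:: 2, 1 & iota 3 n.-1] = false.
  by case: n {IH headA lastA} => [|[]].
have inA w : w \in [seq rcons (rem a (iota 1 n.+1)) a | a <- iota 1 n.-1] ->
    exists2 a, 0 < a < n & w = rcons (rem a (iota 1 n.+1)) a.
  by case/mapP=> a an ->; exists a => //; move: an; rewrite mem_iota; lia.
rewrite [normal_forms _]/=; set C := if _ then _ else _.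
have inC w : w \in C -> [/\ 2 < n, rigid w = false & head 0 w = 2].
  by rewrite /C; case: ifP => // n2; rewrite inE => /eqP ->; rewrite rigidC.
rewrite cat_uniq map_inj_uniq ?IH => [|? ? []] //=.
rewrite mem_cat cat_uniq; apply/and5P; split.
- rewrite negb_or; apply/andP; split.
    apply/mapP => -[v nv [en _]]; case: n nv en {IH headA lastA rigidC inA C inC} => //.
  rewrite has_cat negb_or; apply/andP; split; apply/hasPn => w.
    by case/inA => a an ->; apply/mapP => -[v _]; apply: headA.
  by case/inC => n2 _ hw; apply/mapP => -[v _ ew]; move: hw; rewrite ew /=; lia.
- rewrite negb_or; apply/andP; split; apply/negP.
    by case/inA => a an /esym; apply: lastA.
  by case/inC => _ /negP[]; apply: (@sorted_rigid (iota 1 n.+1)); apply: iota_ltn_sorted.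
- rewrite map_inj_in_uniq ?iota_uniq // => a b _ _ /(congr1 (last 0)).
  by rewrite !last_rcons.
- apply/hasPn => w /inC[_ rw _]; apply/negP => /inA[a an ew].
  by move: rw; rewrite ew low_ended_rigid //; apply: low_ended_normal.
- by rewrite /C; case: ifP.
Qed.

Lemma normal_forms_size n : 3 <= n -> size (normal_forms n) = n * (n + 1) %/ 2 - 2.
Proof.
move=> n3; suff : 2 * (size (normal_forms n) + 2) = n * (n + 1) by lia.
elim: n n3 => // n IH; rewrite leq_eqVlt => /orP[/eqP[<-] //|n3].
rewrite [normal_forms _]/= size_cat /= size_cat !size_map size_iota -ltnS n3 /=.
move: (IH n3); nia.
Qed.

(** * Permutations as words *)

Lemma nth_one_line n (p : 'S_n) (i : 'I_n) : nth 0 (one_line p) i = (p i).+1.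
Proof. by rewrite (nth_map i) ?size_enum_ord // nth_ord_enum. Qed.

Lemma size_one_line n (p : 'S_n) : size (one_line p) = n.
Proof. by rewrite size_map size_enum_ord. Qed.

Lemma one_line_perm n (p : 'S_n) : perm_eq (one_line p) (iota 1 n).
Proof.
have -> : iota 1 n = [seq (val i).+1 | i <- enum 'I_n].
  by rewrite (map_comp succn val) val_enum_ord (iotaDl 1 0).
rewrite /one_line (map_comp (fun i : 'I_n => (val i).+1) p); apply: perm_map.
apply: uniq_perm; rewrite ?(map_inj_uniq (@perm_inj _ p)) ?enum_uniq //.
by move=> i; rewrite mem_enum inE -[i](permKV p) map_f // mem_enum.
Qed.

Lemma one_line_onto n (w : seq nat) : perm_eq w (iota 1 n.+1) ->
  exists p : 'S_n.+1, one_line p = w.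
Proof.
move=> pw; have sw : size w = n.+1 by rewrite (perm_size pw) size_iota.
have uw : uniq w by rewrite (perm_uniq pw) iota_uniq.
have wP (i : 'I_n.+1) : 0 < nth 0 w i <= n.+1.
  have : nth 0 w i \in w by rewrite mem_nth ?sw.
  by rewrite (perm_mem pw) mem_iota; lia.
have inj_f : injective (fun i : 'I_n.+1 => inord (nth 0 w i).-1 : 'I_n.+1).
  move=> i j /(congr1 val); have := wP i; have := wP j.
  rewrite /= => wj wi; rewrite !inordK; [|lia|lia] => e.
  have {}e : nth 0 w i = nth 0 w j.
    by move: wi wj e; case: (nth 0 w i) (nth 0 w j) => [|a] [|b] //= _ _ ->.
  by apply/val_inj/eqP; rewrite -(nth_uniq 0 _ _ uw) ?sw ?e //; apply: ltn_ord.
exists (perm inj_f); apply: (@eq_from_nth _ 0); first by rewrite size_one_line sw.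
move=> k; rewrite size_one_line => kn.
by rewrite (nth_one_line _ (Ordinal kn)) permE inordK; have := wP (Ordinal kn) => /=; lia.
Qed.

(** The order permutation in terms of words, which lets concrete one-line
    notations be substituted for s. *)
Lemma order_permE c (s : 'S_c) u : order_perm s u <->
  size u = c /\ forall i j, i < c -> j < c ->
    (nth 0 (one_line s) i < nth 0 (one_line s) j) = (nth 0 u i < nth 0 u j).
Proof.
split=> -[szu h]; split=> // i j.
  by move=> ic jc; rewrite (nth_one_line s (Ordinal ic)) (nth_one_line s (Ordinal jc)) ltnS h.
by rewrite -h // !nth_one_line.
Qed.

Lemma replacement_step_eqv n (phi psi : 'S_n) :
  replacement_step K_132_312_321_213 phi psi -> eqv (one_line phi) (one_line psi).
Proof.
case=> [l [u [v [r [s [t [B [e1 e2 /order_permE[su hs] /order_permE[sv ht] [BK sB tB]]]]]]]]].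
rewrite e1 e2; apply: eqv_catl; apply: eqv_catr.
have puv : perm_eq u v.
  have := one_line_perm phi; rewrite -(permPr (one_line_perm psi)) e1 e2.
  by rewrite perm_cat2l perm_cat2r.
have uu : uniq u.
  have := one_line_perm phi => /perm_uniq; rewrite iota_uniq e1 !cat_uniq.
  by case/and3P => _ _ /andP[].
have uv : uniq v by rewrite -(perm_uniq puv).
case: u su => [|x [|y [|z []]]] // _ in uu hs puv {e1} *.
case: v sv => [|x' [|y' [|z' []]]] // _ in uv ht puv {e2} *.
have mx : x' \in [:: x; y; z] by rewrite (perm_mem puv) !inE eqxx.
have my : y' \in [:: x; y; z] by rewrite (perm_mem puv) !inE eqxx ?orbT.
have mz : z' \in [:: x; y; z] by rewrite (perm_mem puv) !inE eqxx ?orbT.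
have cmp (w : seq nat) (p q m : nat) : (forall i j, i < 3 -> j < 3 ->
    (nth 0 w i < nth 0 w j) = (nth 0 [:: p; q; m] i < nth 0 [:: p; q; m] j)) ->
  [/\ (nth 0 w 0 < nth 0 w 1) = (p < q), (nth 0 w 0 < nth 0 w 2) = (p < m)
    & (nth 0 w 1 < nth 0 w 2) = (q < m)].
  by move=> h; rewrite (h 0 1) ?(h 0 2) ?(h 1 2).
case: (cmp _ _ _ _ hs) => s1 s2 s3; case: (cmp _ _ _ _ ht) => t1 t2 t3 {hs ht cmp}.
move: uu uv mx my mz {puv}; rewrite /= !inE => uu uv mx my mz.
move: BK; rewrite !inE -orbA => /or3P[/eqP eB|/eqP eB|/imsetP[s' _ eB]].
- move: sB tB; rewrite eB !inE.
  case/orP=> /eqP es /orP[/eqP et|/eqP et]; rewrite es in s1 s2 s3; rewrite et in t1 t2 t3;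
    move: s1 s2 s3 t1 t2 t3 => /= s1 s2 s3 t1 t2 t3.
  + have [-> [-> ->]] : x' = x /\ y' = y /\ z' = z by lia. exact: eqv_refl.
  + have [-> [-> ->]] : x' = y /\ y' = x /\ z' = z by lia. by apply: eqv_132; lia.
  + have [-> [-> ->]] : x' = y /\ y' = x /\ z' = z by lia. by apply/eqv_sym/eqv_132; lia.
  + have [-> [-> ->]] : x' = x /\ y' = y /\ z' = z by lia. exact: eqv_refl.
- move: sB tB; rewrite eB !inE.
  case/orP=> /eqP es /orP[/eqP et|/eqP et]; rewrite es in s1 s2 s3; rewrite et in t1 t2 t3;
    move: s1 s2 s3 t1 t2 t3 => /= s1 s2 s3 t1 t2 t3.
  + have [-> [-> ->]] : x' = x /\ y' = y /\ z' = z by lia. exact: eqv_refl.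
  + have [-> [-> ->]] : x' = y /\ y' = z /\ z' = x by lia. by apply/eqv_sym/eqv_213; lia.
  + have [-> [-> ->]] : x' = z /\ y' = x /\ z' = y by lia. by apply: eqv_213; lia.
  + have [-> [-> ->]] : x' = x /\ y' = y /\ z' = z by lia. exact: eqv_refl.
- move: sB tB; rewrite eB !inE => /eqP es /eqP et.
  rewrite es in s1 s2 s3; rewrite et in t1 t2 t3.
  have [-> [-> ->]] : x' = x /\ y' = y /\ z' = z by lia. exact: eqv_refl.
Qed.

Lemma step_replacement n (phi psi : 'S_n) :
  step (one_line phi) (one_line psi) -> replacement_step K_132_312_321_213 phi psi.
Proof.
have decomp w w' : step w w' -> exists l r a b c, [/\ a < b, b < c &
    (w = l ++ [:: a; c; b] ++ r /\ w' = l ++ [:: c; a; b] ++ r) \/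
    (w = l ++ [:: b; a; c] ++ r /\ w' = l ++ [:: c; b; a] ++ r)].
  elim=> [a b c r ab bc|a b c r ab bc|h u v _ [l [r [a [b [c [ab bc H]]]]]]].
  - by exists [::], r, a, b, c; split; auto.
  - by exists [::], r, a, b, c; split; auto.
  - exists (h :: l), r, a, b, c; split=> //.
    by case: H => -[-> ->]; auto.
case/decomp => l [r [a [b [c [ab bc H]]]]].
case: H => -[ew ew'].
- have [s es] := @one_line_onto3 [:: 1; 3; 2] isT.
  have [t et] := @one_line_onto3 [:: 3; 1; 2] isT.
  exists l, [:: a; c; b], [:: c; a; b], r, s, t,
    (listed_part 3 [:: [:: 1; 3; 2]; [:: 3; 1; 2]]).
  have [os ot] : order_perm s [:: a; c; b] /\ order_perm t [:: c; a; b].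
    split; apply/order_permE; split; rewrite ?es ?et // => i j.
      by case: i j => [|[|[|i]]] [|[|[|j]]] //= _ _; lia.
    by case: i j => [|[|[|i]]] [|[|[|j]]] //= _ _; lia.
  by split=> //; rewrite !inE es et !eqxx ?orbT.
- have [s es] := @one_line_onto3 [:: 2; 1; 3] isT.
  have [t et] := @one_line_onto3 [:: 3; 2; 1] isT.
  exists l, [:: b; a; c], [:: c; b; a], r, s, t,
    (listed_part 3 [:: [:: 3; 2; 1]; [:: 2; 1; 3]]).
  have [os ot] : order_perm s [:: b; a; c] /\ order_perm t [:: c; b; a].
    split; apply/order_permE; split; rewrite ?es ?et // => i j.
      by case: i j => [|[|[|i]]] [|[|[|j]]] //= _ _; lia.
    by case: i j => [|[|[|i]]] [|[|[|j]]] //= _ _; lia.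
  by split=> //; rewrite !inE es et !eqxx ?orbT.
Qed.

Lemma K_equivE n (phi psi : 'S_n.+1) :
  K_equiv K_132_312_321_213 phi psi <-> eqv (one_line phi) (one_line psi).
Proof.
split.
  elim=> [p q /replacement_step_eqv //|p|p q _ /eqv_sym //|p q r _ pq _ qr].
    exact: eqv_refl.
  exact: eqv_trans pq qr.
suff H w w' : eqv w w' -> forall p q : 'S_n.+1, one_line p = w -> one_line q = w' ->
    K_equiv K_132_312_321_213 p q.
  by move=> e; apply: H e _ _ erefl erefl.
elim=> {w w'}.
- move=> w w' st p q ew ew'; apply: rst_step; apply: step_replacement.
  by rewrite ew ew'.
- by move=> w p q ew ew'; rewrite (@one_line_inj _ p q) ?ew //; apply: rst_refl.
- by move=> w w' _ IH p q ew ew'; apply: rst_sym; apply: IH.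
- move=> w w' w'' ww' IH1 _ IH2 p q ew ew''.
  have [r er] : exists r : 'S_n.+1, one_line r = w'.
    by apply: one_line_onto; rewrite -(permPl (eqv_perm ww')) -ew one_line_perm.
  exact: rst_trans (IH1 p r ew er) (IH2 r q er ew'').
Qed.

Theorem proposition3p17 (n : nat) (hn : 3 <= n) :
  #|K_classes K_132_312_321_213 n| = n * (n + 1) %/ 2 - 2.
Proof.
rewrite -(normal_forms_size hn); case: n hn => // n _.
(* The normal forms are a transversal of the classes. *)
set cls := fun phi : 'S_n.+1 =>
  [set psi in [set: 'S_n.+1] | `[< K_equiv K_132_312_321_213 phi psi >]].
have clsE phi psi : (psi \in cls phi) = `[< eqv (one_line phi) (one_line psi) >].
  by rewrite !inE; apply: asbool_equiv_eq; apply: K_equivE.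
set T := [set phi : 'S_n.+1 | one_line phi \in normal_forms n.+1].
have -> : K_classes K_132_312_321_213 n.+1 = cls @: T.
  apply/setP => B; apply/imsetP/imsetP => -[phi _ ->]; last by exists phi.
  have [w nw e] := normal_forms_complete (one_line_perm phi).
  have [psi epsi] := one_line_onto (normal_forms_perm nw).
  exists psi; first by rewrite inE epsi.
  apply/setP => chi; rewrite -/(cls phi) !clsE epsi; apply: asbool_equiv_eq.
  by split; apply: eqv_trans; first exact: eqv_sym.
rewrite card_in_imset => [|phi psi].
  have /perm_size <- : perm_eq [seq one_line phi | phi <- enum T] (normal_forms n.+1).
    apply: uniq_perm; [| exact: normal_forms_uniq |].
      by rewrite (map_inj_uniq (@one_line_inj _)) enum_uniq.
    move=> w; apply/mapP/idP => [[phi]|nw]; first by rewrite mem_enum inE => ? ->.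
    have [phi ephi] := one_line_onto (normal_forms_perm nw).
    by exists phi; rewrite ?mem_enum ?inE ephi.
  by rewrite size_map cardE.
rewrite !inE => nphi npsi ecls; apply: one_line_inj; apply: normal_forms_inj nphi npsi _.
by apply/asboolP; rewrite -clsE ecls clsE; apply/asboolP; apply: eqv_refl.
Qed.
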